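(* Let $n>1000$ be an integer and let $A>8$ be a real number. Consider the random graph $G(n,1/n)$, let $\mathcal{C}_1$ denote its largest connected component, and for a vertex $v$ let $C(v)$ denote the connected component containing $v$. Then for every vertex $v$ $$\mathbf{P}\big(|C(v)|>An^{2/3}\big)\le 4n^{-1/3}e^{-\frac{A^2(A-4)}{32}},$$ and $$\mathbf{P}\big(|\mathcal{C}_1|>An^{2/3}\big)\le \frac{4}{A}\,e^{-\frac{A^2(A-4)}{32}}.$$
   Context: The random graph $G(n,p)$ is obtained from the complete graph on $n$ (labelled) vertices by independently retaining each edge with probability $p$ and deleting it with probability $1-p$. For a connected component $C$, $|C|$ denotes its number of vertices; $|\mathcal{C}_1|$ is the maximal number of vertices in a connected component. The vertex $v$ is a fixed (deterministic) vertex. *)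

(* Defs.v *)
From mathcomp Require Import all_boot all_order all_algebra.
From mathcomp Require Import reals.

Set Implicit Arguments.
Unset Strict Implicit.
Unset Printing Implicit Defensive.

Import Order.TTheory GRing.Theory Num.Theory.

Local Open Scope ring_scope.

(* A graph on the vertex set 'I_n is encoded by its set of
   edges, an edge being a two-element set of vertices. *)

Definition complete_graph (n : nat) : {set {set 'I_n}} :=
  [set e : {set 'I_n} | #|e| == 2%N].

Definition adjacent (n : nat) (G : {set {set 'I_n}}) : rel 'I_n :=
  fun u v => [set u; v] \in G.

Definition component (n : nat) (G : {set {set 'I_n}}) (v : 'I_n) : {set 'I_n} :=
  [set w | connect (adjacent G) v w].

Definition components (n : nat) (G : {set {set 'I_n}}) : {set {set 'I_n}} :=
  [set component G v | v : 'I_n].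

Definition largest_component_size (n : nat) (G : {set {set 'I_n}}) : nat :=
  \max_(C in components G) #|C|.

(* The probability that G(n, p) equals the subgraph G of the complete graph:
   each edge of the complete graph is retained with probability p and deleted
   with probability 1 - p, independently. *)
Definition gnp_weight (R : realType) (n : nat) (p : R) (G : {set {set 'I_n}}) :
    R :=
  \prod_(e in complete_graph n) (if e \in G then p else 1 - p).

(* The probability that G(n, p) has the property E. *)
Definition gnp_prob (R : realType) (n : nat) (p : R)
    (E : pred {set {set 'I_n}}) : R :=
  \sum_(G in powerset (complete_graph n) | E G) gnp_weight p G.

Lemma gnp_prob_total (R : realType) (n : nat) (p : R) :
  gnp_prob p (@predT {set {set 'I_n}}) = 1.
Proof.
rewrite /gnp_prob; set K := complete_graph n.
pose F e := if e \in K then p else 0; pose F' e := if e \in K then 1 - p else 1.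
have <- : \prod_e (F e + F' e) = 1.
  by apply: big1 => e _; rewrite /F /F'; case: ifP; rewrite ?add0r // addrC subrK.
rewrite bigA_distr [RHS](bigID [in powerset K]) /= [X in _ = (_ + X)%R]big1 ?addr0.
  apply: eq_big => [G|G]; first by rewrite andbT.
  rewrite andbT powersetE => /subsetP GK.
  rewrite /gnp_weight big_mkcond /=; apply: eq_bigr => e _.
  by rewrite /F /F' -/K; have [/GK ->|_] := boolP (e \in G).
move=> G; rewrite powersetE => /subsetPn[e eG eK].
by rewrite (bigD1 e) //= eG /F (negbTE eK) mul0r.
Qed.

(* Main.v *)
Require Import Defs.
From mathcomp Require Import all_boot all_order all_algebra.
From mathcomp Require Import reals sequences exp.
From mathcomp Require Import ring lra.

Set Implicit Arguments.
Unset Strict Implicit.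
Unset Printing Implicit Defensive.

Import Order.TTheory GRing.Theory Num.Theory.

Local Open Scope ring_scope.

(** Explore the component of [v] one vertex at a time: keep a set [S] of active
    vertices and a set [N] of unseen ones, pick an active vertex, find its
    neighbours in [N], make them active and discard it.  The neighbours form a
    binomial subset [X] of [N], independent of the rest of the graph, so the
    number [s] of active vertices is a random walk with steps [#|X| - 1].  At
    [p = 1 / n] the drift of the walk after [t] steps is at most [- t / n],
    because at most [n - t] vertices are unseen.  The component has more than [k]
    vertices exactly when the walk, started at 1, stays positive for [k] steps;
    [survival] is the probability of this, and [survival_step] is the
    one-step inequality that drives everything.

    The exponential factor is a Chernoff bound: by induction on [k],
    [survival_le_exp] shows that survival for [k] steps from [s] active vertices
    has probability at most [exp (c s + c^2 k - c k^2 / (2 n))], where the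
    quadratic gain is the accumulated drift.

    The factor [n^(-1/3)] is the cost of keeping a critical walk positive for
    about [n^(2/3)] steps.  It comes from averaging over the moment at which the
    Chernoff bound takes over: survival for [K + k] steps is at most the average
    over [i < k] of survival for [K + i] steps, hence at most [L / k] times the
    sum of the expectations of [exp (c s_i)] over the walks alive at time [i < k]
    ([L] being the Chernoff factor for [K] steps).  Write
    [exp (c s) = exp (- 2 c s) + (exp (c s) - exp (- 2 c s))].  With
    [l = exp (c^2)], one step multiplies [exp (c s)] by at most [l] and
    [exp (- 2 c s)] by at least [l], in expectation.  So the bracket, which
    vanishes at [s = 0], grows at most by the factor [l], and contributes at most
    [l^k] times its initial value, which is of order [c].  On the other hand
    [1 - exp (- 2 c s)] decreases in expectation by at least
    [(l - 1) exp (- 2 c s)] at each step, so the expectations of the first term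
    sum to at most [(1 - exp (- 2 c)) / (l - 1)], which is of order [1 / c].  The
    total is [2 / (c k) + 4 c] up to the factor [l^k]
    ([sum_survival_le], [survival_le_prefactor]).  Taking
    [c = A n^(-1/3) / 4], [k] near [n^(2/3)] and [K + k] near [A n^(2/3)] gives
    the first bound ([component_tail_numeric]).

    The second bound is Markov's inequality: a component with more than [T]
    vertices makes more than [T] vertices [v] satisfy [#|C(v)| > T]
    ([gnp_prob_largest_le]). *)

(** * Expectations over the random graph *)

Definition gnp_expect (R : realType) (n : nat) (p : R)
    (F : {set {set 'I_n}} -> R) : R :=
  \sum_(G in powerset (complete_graph n)) gnp_weight p G * F G.

Lemma gnp_probE (R : realType) (n : nat) (p : R) (E : pred {set {set 'I_n}}) :
  gnp_prob p E = gnp_expect p (fun G => (E G)%:R).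
Proof.
rewrite /gnp_prob /gnp_expect big_mkcondr /=; apply: eq_bigr => G _.
by case: (E G); rewrite ?mulr1 ?mulr0.
Qed.

Lemma gnp_expect1 (R : realType) (n : nat) (p : R) :
  gnp_expect p (fun _ : {set {set 'I_n}} => 1) = 1.
Proof. by have := gnp_prob_total n p; rewrite gnp_probE. Qed.

Lemma gnp_weight_ge0 (R : realType) (n : nat) (p : R) (G : {set {set 'I_n}}) :
  0 <= p <= 1 -> 0 <= gnp_weight p G.
Proof.
by move=> /andP[p0 p1]; apply: prodr_ge0 => e _; case: ifP; rewrite // subr_ge0.
Qed.

Lemma gnp_expect_le (R : realType) (n : nat) (p : R)
    (F F' : {set {set 'I_n}} -> R) :
  0 <= p <= 1 -> (forall G, F G <= F' G) -> gnp_expect p F <= gnp_expect p F'.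
Proof.
by move=> p01 FF'; apply: ler_sum => G _; rewrite ler_wpM2l ?gnp_weight_ge0.
Qed.

Lemma eq_gnp_expect (R : realType) (n : nat) (p : R)
    (F F' : {set {set 'I_n}} -> R) :
  F =1 F' -> gnp_expect p F = gnp_expect p F'.
Proof. by move=> FF'; apply: eq_bigr => G _; rewrite FF'. Qed.

(** Rerandomizing a single edge leaves the law of the random graph unchanged:
    both sides are the same average, over the graphs that avoid [e], of the
    two ways of completing them at [e]. *)
Lemma gnp_expect_resample (R : realType) (n : nat) (p : R) (e : {set 'I_n})
    (F : {set {set 'I_n}} -> R) :
  e \in complete_graph n ->
  gnp_expect p F =
  p * gnp_expect p (fun G => F (e |: G))
    + (1 - p) * gnp_expect p (fun G => F (G :\ e)).
Proof.
move=> eK; set K := complete_graph n.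
pose w (G : {set {set 'I_n}}) : R := \prod_(e' in K | e' != e) (if e' \in G then p else 1 - p).
have wE G : gnp_weight p G = (if e \in G then p else 1 - p) * w G.
  by rewrite /gnp_weight (bigD1 e).
have wU G : w (e |: G) = w G.
  by apply: eq_bigr => e' /andP[_ /negbTE ne]; rewrite !inE ne.
have split F0 : gnp_expect p F0 =
    \sum_(G in powerset K | e \notin G)
       (p * w G * F0 (e |: G) + (1 - p) * w G * F0 G).
  rewrite /gnp_expect (bigID (fun G : {set {set 'I_n}} => e \in G)) /= big_split /=.
  congr (_ + _).
    rewrite (reindex_onto (fun G => e |: G) (fun G => G :\ e)) /=; last first.
      by move=> G /andP[_ eG]; rewrite setD1K.
    apply: eq_big => [G|G]; last first.
      by move=> _; rewrite wE setU11 wU.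
    rewrite setU11 andbT !powersetE subUset sub1set eK /=.
    congr (_ && _); apply/eqP/idP => [<-|eG]; first by rewrite !inE eqxx.
    by rewrite setU1K.
  by apply: eq_bigr => G /andP[_ /negbTE eG]; rewrite wE eG.
rewrite !split !mulr_sumr -big_split /=; apply: eq_bigr => G /andP[_ eG].
have GD : G :\ e = G.
  by apply/setP => e'; rewrite !inE; case: eqP => // ->; rewrite (negbTE eG).
by rewrite setUA setUid setU1K // GD; ring.
Qed.

(** * Binomial random subsets *)

(** Expectation for the product of Bernoulli laws of parameter [p] on the points
    of [M]. *)
Definition subset_expect (R : realType) (T : finType) (p : R) (M : {set T})
    (g : {set T} -> R) : R :=
  \sum_(X in powerset M) p ^+ #|X| * (1 - p) ^+ #|M :\: X| * g X.

Lemma subset_expect0 (R : realType) (T : finType) (p : R) (g : {set T} -> R) :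
  subset_expect p set0 g = g set0.
Proof.
by rewrite /subset_expect powerset0 big_set1 setDv !cards0 !expr0 !mul1r.
Qed.

Lemma subset_expectU1 (R : realType) (T : finType) (p : R) (w : T) (M : {set T})
    (g : {set T} -> R) :
  w \notin M ->
  subset_expect p (w |: M) g =
  p * subset_expect p M (fun X => g (w |: X)) + (1 - p) * subset_expect p M g.
Proof.
move=> wM; rewrite {1}/subset_expect (bigID (fun X : {set T} => w \in X)) /= !mulr_sumr.
have XM (X : {set T}) : X \in powerset M -> w \notin X.
  by rewrite powersetE => /subsetP XM; apply: contra wM => /XM.
congr (_ + _).
  rewrite (reindex_onto (fun X => w |: X) (fun X => X :\ w)) /=; last first.
    by move=> X /andP[_ wX]; rewrite setD1K.
  have idx (X : {set T}) : (w |: X \in powerset (w |: M)) && (w \in w |: X)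
      && ((w |: X) :\ w == X) = (X \in powerset M).
    rewrite setU11 andbT; apply/andP/idP => [[+ /eqP <-]|XPM].
      by rewrite !powersetE subDset.
    by rewrite setU1K ?XM //; move: XPM; rewrite !powersetE => /setUS ->.
  apply: eq_big => // X; rewrite idx => XPM.
  rewrite cardsU1 XM //= exprS.
  have -> : (w |: M) :\: (w |: X) = M :\: X.
    apply/setP => u; rewrite !inE; have [->|] //= := eqVneq u w.
    by rewrite (negbTE wM) andbF.
  by rewrite !mulrA.
apply: eq_big => [X|X].
  apply/andP/idP => [[]|XPM]; last first.
    by rewrite XM //; move: XPM; rewrite !powersetE => XPM; rewrite subsetU ?XPM ?orbT.
  rewrite !powersetE => /subsetP XwM wX; apply/subsetP => u uX.
  by move: (XwM u uX); rewrite !inE; case: eqP uX wX => // -> ->.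
move=> /andP[_ wX].
have -> : (w |: M) :\: X = w |: (M :\: X).
  by apply/setP => u; rewrite !inE; case: eqP => // ->; rewrite wX.
by rewrite cardsU1 !inE (negbTE wM) andbF /= exprS; ring.
Qed.

Lemma subset_expect_le (R : realType) (T : finType) (p : R) (M : {set T})
    (g h : {set T} -> R) :
  0 <= p <= 1 -> (forall X : {set T}, X \subset M -> g X <= h X) ->
  subset_expect p M g <= subset_expect p M h.
Proof.
move=> /andP[p0 p1] gh; apply: ler_sum => X; rewrite powersetE => XM.
by apply: ler_wpM2l; rewrite ?gh // mulr_ge0 // exprn_ge0 // subr_ge0.
Qed.

(** Probability generating function of the size of the subset: the points
    contribute independent factors [1 - p + p z]. *)
Lemma subset_expect_expn (R : realType) (T : finType) (p z : R) (M : {set T}) :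
  subset_expect p M (fun X : {set T} => z ^+ #|X|) = (1 + p * (z - 1)) ^+ #|M|.
Proof.
have [m] := ubnP #|M|; elim: m M => // m IH M.
have [->|[w wM]] := set_0Vmem M; first by rewrite subset_expect0 cards0.
rewrite (cardsD1 w) wM add1n ltnS => ltm.
rewrite -{1}(setD1K wM) subset_expectU1 ?setD11 // IH // exprS.
rewrite [X in p * X](_ : _ = z * subset_expect p (M :\ w) (fun X : {set T} => z ^+ #|X|)).
  by rewrite IH //; ring.
rewrite /subset_expect mulr_sumr; apply: eq_bigr => X.
rewrite powersetE => /subsetP XM.
have wX : w \notin X by apply/negP => /XM; rewrite setD11.
by rewrite cardsU1 wX exprS mulrCA.
Qed.

Lemma subset_expectD (R : realType) (T : finType) (p : R) (M : {set T})
    (g h : {set T} -> R) :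
  subset_expect p M (fun X => g X + h X) = subset_expect p M g + subset_expect p M h.
Proof. by rewrite -big_split; apply: eq_bigr => X _; rewrite mulrDr. Qed.

Lemma subset_expectZ (R : realType) (T : finType) (p a : R) (M : {set T})
    (g : {set T} -> R) :
  subset_expect p M (fun X => a * g X) = a * subset_expect p M g.
Proof. by rewrite mulr_sumr; apply: eq_bigr => X _; rewrite mulrCA. Qed.

Lemma subset_expect_sum (R : realType) (T : finType) (p : R) (M : {set T}) (j : nat)
    (g : 'I_j -> {set T} -> R) :
  \sum_(i < j) subset_expect p M (g i) = subset_expect p M (fun X => \sum_(i < j) g i X).
Proof.
by rewrite /subset_expect exchange_big; apply: eq_bigr => X _; rewrite mulr_sumr.
Qed.

(** * Exploration of a component *)

Definition neighbours (n : nat) (G : {set {set 'I_n}}) (a : 'I_n) (M : {set 'I_n}) :=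
  [set w in M | Defs.adjacent G a w].

Lemma star_edge_inj (n : nat) (a u w : 'I_n) :
  w != a -> ([set a; u] == [set a; w]) = (u == w).
Proof.
move=> wa; apply/eqP/eqP => [E|->] //.
have : w \in [set a; u] by rewrite E !inE eqxx orbT.
by rewrite !inE (negbTE wa) => /eqP.
Qed.

Definition agree_off (n : nat) (a : 'I_n) (G G' : {set {set 'I_n}}) : Prop :=
  forall e : {set 'I_n}, a \notin e -> (e \in G) = (e \in G').

(** The neighbours of [a] inside [M] form a binomial subset of [M], independent
    of everything determined by the edges that avoid [a].  The edges from [a] to
    [M] are rerandomized one after the other. *)
Lemma gnp_expect_neighbours (R : realType) (n : nat) (p : R) (a : 'I_n)
    (M : {set 'I_n}) (F : {set 'I_n} -> {set {set 'I_n}} -> R) :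
  a \notin M ->
  (forall X G G', agree_off a G G' -> F X G = F X G') ->
  gnp_expect p (fun G => F (neighbours G a M) G) =
  subset_expect p M (fun X => gnp_expect p (F X)).
Proof.
have [m] := ubnP #|M|; elim: m M F => // m IH M F.
have [->|[w wM]] := set_0Vmem M.
  move=> _ _ _; rewrite subset_expect0; apply: eq_gnp_expect => G; congr (F _ G).
  by apply/setP => u; rewrite !inE.
rewrite (cardsD1 w) wM add1n ltnS => ltm aM Finv.
have wa : w != a by apply: contraNneq aM => <-.
have eK : [set a; w] \in complete_graph n by rewrite inE cards2 (eq_sym a) wa.
have aM' : a \notin M :\ w by rewrite !inE negb_and aM orbT.
rewrite -{2}(setD1K wM) subset_expectU1 ?setD11 //.
rewrite -(IH _ (fun X => F (w |: X))) // => [|X G G' GG']; last exact: Finv.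
rewrite -(IH _ F) // (gnp_expect_resample _ _ eK).
congr (_ * _ + _ * _); apply: eq_gnp_expect => G.
  rewrite (Finv _ _ G) => [|e ae]; last first.
    by rewrite !inE; case: eqP ae => // ->; rewrite !inE eqxx.
  congr (F _ G); apply/setP => u; rewrite !inE /Defs.adjacent !inE star_edge_inj //.
  by case: eqP => // ->; rewrite wM.
rewrite (Finv _ _ G) => [|e ae]; last first.
  by rewrite !inE; case: eqP ae => // ->; rewrite !inE eqxx.
congr (F _ G); apply/setP => u; rewrite !inE /Defs.adjacent !inE star_edge_inj //.
by rewrite andbCA andbA.
Qed.

(** The vertices found by the exploration from the active set [S] with unseen set
    [N].  Only the arrival vertex of a step has to be unseen: the edges inside [S]
    have no influence, so nothing is assumed about them when a vertex becomes
    active. *)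
Definition reach (n : nat) (G : {set {set 'I_n}}) (S N : {set 'I_n}) : {set 'I_n} :=
  [set w | [exists s in S,
     connect (fun u w => Defs.adjacent G u w && (w \in N)) s w]].

Lemma sub_reach (n : nat) (G : {set {set 'I_n}}) (S N : {set 'I_n}) :
  S \subset reach G S N.
Proof.
by apply/subsetP => s sS; rewrite inE; apply/existsP; exists s; rewrite sS connect0.
Qed.

Lemma reach_step (n : nat) (G : {set {set 'I_n}}) (S N : {set 'I_n}) (u w : 'I_n) :
  u \in reach G S N -> Defs.adjacent G u w -> w \in N -> w \in reach G S N.
Proof.
rewrite !inE => /existsP[s /andP[sS su]] uw wN; apply/existsP; exists s.
by rewrite sS (connect_trans su) // connect1 // uw.
Qed.

Lemma reach_min (n : nat) (G : {set {set 'I_n}}) (S N B : {set 'I_n}) :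
  S \subset B ->
  (forall u w, u \in B -> Defs.adjacent G u w -> w \in N -> w \in B) ->
  reach G S N \subset B.
Proof.
move=> /subsetP SB Bstep; apply/subsetP => w; rewrite inE => /existsP[s /andP[sS]].
move=> /connectP[q path_q ->] {w}.
elim: q s path_q {sS}(SB s sS) => //= w q IH s /andP[/andP[sw wN] path_q] sB.
exact: IH path_q (Bstep _ _ sB sw wN).
Qed.

Lemma sub_reach_component (n : nat) (G : {set {set 'I_n}}) (v : 'I_n) :
  component G v \subset reach G [set v] (~: [set v]).
Proof.
apply/subsetP => w; rewrite inE => /connectP[q path_q ->] {w}.
set B := reach _ _ _.
have vB : v \in B by rewrite (subsetP (sub_reach _ _ _)) ?set11.
have: v \in B by []; elim: q {1 2 3}v path_q => //= w q IH u /andP[uw path_q] uB.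
apply: IH path_q _; have [-> //|wv] := eqVneq w v.
by apply: reach_step uB uw _; rewrite !inE.
Qed.

(** One step of the exploration loses nothing but the discarded vertex [a]: the
    right-hand side contains [S] and is closed under steps into [N], since a step
    from [a] arrives in the neighbours, which have become active. *)
Lemma reach_explore (n : nat) (G : {set {set 'I_n}}) (a : 'I_n) (S N : {set 'I_n}) :
  reach G S N \subset
  a |: reach G (S :\ a :|: neighbours G a N) (N :\: neighbours G a N).
Proof.
set X := neighbours G a N; set B := reach _ (_ :|: X) _.
have SB : S :\ a :|: X \subset B by exact: sub_reach.
apply: reach_min => [|u w].
  apply/subsetP => s sS; rewrite in_setU1; have [//|sa] := eqVneq s a.
  by rewrite (subsetP SB) // in_setU in_setD1 sa sS.
rewrite in_setU1 => /predU1P[->|uB] uw wN.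
  by rewrite in_setU1 (subsetP SB) ?orbT // !inE wN uw orbT.
rewrite in_setU1; apply/orP; right; have [wX|wX] := boolP (w \in X).
  by rewrite (subsetP SB) // inE wX orbT.
by apply: reach_step uB uw _; rewrite inE wX.
Qed.

(** Once [a] has been discarded, no step of the exploration uses an edge at [a];
    this is what makes the future independent of the neighbours of [a]. *)
Lemma reach_eq (n : nat) (G G' : {set {set 'I_n}}) (a : 'I_n) (S N : {set 'I_n}) :
  agree_off a G G' ->
  a \notin S -> a \notin N -> reach G S N = reach G' S N.
Proof.
move=> GG' aS aN.
suff sub H H' : agree_off a H H' -> reach H S N \subset reach H' S N.
  by apply/eqP; rewrite eqEsubset !sub // => e ae; rewrite GG'.
move=> HH'; suff /subset_trans : reach H S N \subset reach H' S N :\ a.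
  by apply; rewrite subD1set.
apply: reach_min => [|u w].
  by rewrite subsetD1 aS sub_reach.
rewrite !in_setD1 => /andP[ua uB] uw wN.
have wa : w != a by apply: contraNneq aN => <-.
rewrite wa (reach_step uB) // /Defs.adjacent -HH' //.
by rewrite !inE negb_or ![a == _]eq_sym ua wa.
Qed.

Definition survival (R : realType) (n : nat) (p : R) (k : nat) (S N : {set 'I_n}) : R :=
  gnp_expect p (fun G => (k < #|reach G S N|)%N%:R).

Lemma survival_le1 (R : realType) (n : nat) (p : R) (k : nat) (S N : {set 'I_n}) :
  0 <= p <= 1 -> survival p k S N <= 1.
Proof.
by move=> p01; rewrite -(gnp_expect1 n p); apply: gnp_expect_le => // G; case: (_ < _)%N.
Qed.

Lemma survival_set0 (R : realType) (n : nat) (p : R) (k : nat) (N : {set 'I_n}) :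
  survival p k set0 N = 0.
Proof.
rewrite /survival /gnp_expect big1 // => G _.
have /eqP -> : reach G set0 N == set0.
  by rewrite -subset0 reach_min ?sub0set // => u w; rewrite inE.
by rewrite cards0 ltn0 mulr0.
Qed.

Lemma survival_mono (R : realType) (n : nat) (p : R) (j k : nat) (S N : {set 'I_n}) :
  0 <= p <= 1 -> (j <= k)%N -> survival p k S N <= survival p j S N.
Proof.
move=> p01 jk; apply: gnp_expect_le => // G; rewrite ler_nat.
by case: ltnP => // /(leq_ltn_trans jk) ->.
Qed.

(** Markov property of the exploration: given the set [X] of neighbours of [a],
    the exploration restarts from [S :\ a :|: X], and only edges avoiding [a]
    matter from then on. *)
Lemma survival_step (R : realType) (n : nat) (p : R) (k : nat) (a : 'I_n)
    (S N : {set 'I_n}) :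
  0 <= p <= 1 -> a \in S -> [disjoint S & N] ->
  survival p k.+1 S N <=
  subset_expect p N (fun X => survival p k (S :\ a :|: X) (N :\: X)).
Proof.
move=> p01 aS SN; have aN : a \notin N by rewrite (disjointFr SN aS).
(* The guard makes [F] independent of the edges at [a] for every [X], not only
   for the subsets of [N]. *)
pose F (X : {set 'I_n}) G : R :=
  ((a \notin X) && (k < #|reach G (S :\ a :|: X) (N :\: X)|)%N)%:R.
have Finv X G G' : agree_off a G G' -> F X G = F X G'.
  move=> GG'; rewrite /F; case: (boolP (a \in X)) => //= aX.
  by rewrite (reach_eq GG') // !inE ?eqxx ?(negbTE aX) ?(negbTE aN).
have E := gnp_expect_neighbours p aN Finv.
apply: (@le_trans _ _ (gnp_expect p (fun G => F (neighbours G a N) G))).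
  apply: gnp_expect_le => // G; rewrite ler_nat /F !inE (negbTE aN) /=.
  case: ltnP => // lek; rewrite lt0b -ltnS; apply: leq_trans lek _.
  apply: leq_trans (subset_leq_card (reach_explore _ a _ _)) _.
  by rewrite cardsU1; case: (_ \notin _); rewrite ?add0n.
rewrite E; apply: subset_expect_le => // X _; apply: gnp_expect_le => // G.
by rewrite ler_nat /F; case: (_ \notin _).
Qed.

(** * Exponential moments of one step *)

(** [expR c] is at most [(1 - c / 2) ^- 2], by squaring [1 - x <= expR (- x)] at
    [x = c / 2]. *)
Lemma expR_le_quadratic (R : realType) (c : R) :
  0 <= c <= 1 / 4 -> expR c <= 1 + c + c ^+ 2.
Proof.
move=> /andP[c0 c1].
have c2 : 1 - c / 2 <= expR (- (c / 2)) by rewrite expR_ge1Dx.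
have E : expR c * expR (- (c / 2)) ^+ 2 = 1.
  by rewrite -expRM_natl -expRD -[RHS]expR0; congr expR; field.
have c2ge0 : 0 < (1 - c / 2) ^+ 2 by rewrite exprn_gt0 //; lra.
rewrite -(ler_pM2r c2ge0); apply: (@le_trans _ _ 1); last first.
  rewrite -subr_ge0 (_ : _ - 1 = c ^+ 2 * ((1 - c) ^+ 2 - c) / 4); last by field.
  by rewrite divr_ge0 // mulr_ge0 ?sqr_ge0 //; have := sqr_ge0 c; lra.
rewrite -[leRHS]E ler_wpM2l ?expR_ge0 // lerXn2r // ?nnegrE ?expR_ge0 //; lra.
Qed.

(** [d] is the number of vertices that have been seen; it provides the negative
    drift [- c d / n]. *)
Lemma binomial_mgf_le (R : realType) (n m d : nat) (c : R) :
  (0 < n)%N -> 0 <= c <= 1 / 4 -> (m + d <= n)%N ->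
  (1 + 1 / n%:R * (expR c - 1)) ^+ m <= expR (c + c ^+ 2 - c * (d%:R / n%:R)).
Proof.
move=> n0 c01 mdn; have nR : (0 : R) < n%:R by rewrite ltr0n.
have [c0 c1] := andP c01; have := expR_le_quadratic c01.
set z := expR c => zle; have z1 : 1 <= z by rewrite /z; have := expR_ge1Dx c; lra.
apply: (@le_trans _ _ (expR (m%:R * (1 / n%:R * (z - 1))))).
  rewrite expRM_natl lerXn2r ?nnegrE ?expR_ge0 ?expR_ge1Dx //.
  by rewrite addr_ge0 // mulr_ge0 ?divr_ge0 // ?ler0n // subr_ge0.
rewrite ler_expR mulrA mulrA mulr1.
have r0 : 0 <= m%:R / n%:R :> R by rewrite divr_ge0 ?ler0n.
have d0 : 0 <= d%:R / n%:R :> R by rewrite divr_ge0 ?ler0n.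
have rd : m%:R / n%:R + d%:R / n%:R <= 1 :> R.
  by rewrite -mulrDl ler_pdivrMr // mul1r -natrD ler_nat.
move: (m%:R / n%:R) (d%:R / n%:R) r0 d0 rd => r d' r0 d0 rd.
apply: (@le_trans _ _ (r * (c + c ^+ 2))); first by rewrite ler_wpM2l //; lra.
apply: (@le_trans _ _ ((1 - d') * (c + c ^+ 2))); last by nra.
by rewrite ler_wpM2r ?addr_ge0 ?sqr_ge0 //; lra.
Qed.

(** The exponent [- 2 c] is what lets the lower bound reach the same growth rate
    [expR (c ^+ 2)] as the upper bound for the exponent [c]: for a
    centred step the logarithm of the moment is [2 c ^+ 2] to second order, and
    half of it is left to absorb the higher order terms. *)
Lemma binomial_mgf_ge (R : realType) (n m : nat) (c : R) :
  (1000 <= n)%N -> 0 <= c <= 1 / 4 -> (m <= n)%N ->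
  expR (c ^+ 2 - 2 * c) <= (1 + 1 / n%:R * (expR (- (2 * c)) - 1)) ^+ m.
Proof.
move=> n1000 c01 mn.
have nR : (0 : R) < n%:R by rewrite ltr0n (leq_trans _ n1000).
have [c0 c1] := andP c01.
set x := 1 - expR (- (2 * c)).
have x0 : 0 <= x by rewrite subr_ge0 -[leRHS]expR0 ler_expR; lra.
have xle : x <= 2 * c - 3 / 2 * c ^+ 2 + c ^+ 3 / 2.
  have c2 : 1 - c / 2 <= expR (- (c / 2)) by rewrite expR_ge1Dx.
  have : (1 - c / 2) ^+ 4 <= expR (- (2 * c)).
    have -> : expR (- (2 * c)) = expR (- (c / 2)) ^+ 4.
      by rewrite -expRM_natl; congr expR; field.
    rewrite lerXn2r ?nnegrE ?expR_ge0 //; lra.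
  rewrite /x; have : 0 <= c ^+ 4 by rewrite exprn_ge0.
  by nra.
have x2c : x <= 2 * c.
  by have := expR_ge1Dx (- (2 * c)); rewrite /x; lra.
set u := x / n%:R.
have -> : 1 + 1 / n%:R * (expR (- (2 * c)) - 1) = 1 - u by rewrite /u /x; ring.
have u0 : 0 <= u by rewrite divr_ge0 ?ler0n.
have ule : u <= c / 500.
  rewrite ler_pdivrMr //; apply: (le_trans x2c).
  have : (1000%:R : R) <= n%:R by rewrite ler_nat.
  by move=> ?; nra.
have mu : m%:R * u <= x.
  by rewrite /u mulrCA ler_piMr // ler_pdivrMr // mul1r ler_nat.
have u1 : 0 < 1 - u by lra.
have lower : expR (- (u / (1 - u))) <= 1 - u.
  rewrite expRN -[leRHS]invrK lef_pV2 ?posrE ?expR_gt0 ?invr_gt0 //.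
  apply: le_trans (expR_ge1Dx _).
  by rewrite le_eqVlt; apply/orP; left; apply/eqP; field; rewrite gt_eqF.
apply: (@le_trans _ _ (expR (- (u / (1 - u))) ^+ m)); last first.
  by rewrite lerXn2r ?nnegrE ?expR_ge0 // ltW.
rewrite -expRM_natl ler_expR.
suff : m%:R * (u / (1 - u)) <= 2 * c - c ^+ 2 by lra.
rewrite mulrA ler_pdivrMr //.
apply: (le_trans mu); apply: (le_trans xle).
have : c ^+ 3 <= c ^+ 2 / 4 by rewrite exprS; have := sqr_ge0 c; nra.
have : 0 <= c ^+ 2 by apply: sqr_ge0.
have : (2 * c - c ^+ 2) * u <= 2 * c * (c / 500).
  by apply: ler_pM => //; have := sqr_ge0 c; nra.
by nra.
Qed.

(** * Survival of the exploration at the critical probability *)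

Lemma inv_nat_prob (R : realType) (n : nat) : (0 < n)%N -> 0 <= (1 / n%:R : R) <= 1.
Proof.
move=> n0; apply/andP; split; first by rewrite divr_ge0 ?ler0n.
by rewrite ler_pdivrMr ?ltr0n // mul1r ler1n.
Qed.

Lemma disjoint_explore (n : nat) (a : 'I_n) (S N X : {set 'I_n}) :
  [disjoint S & N] -> X \subset N -> [disjoint S :\ a :|: X & N :\: X].
Proof.
move=> SN XN; rewrite -setI_eq0; apply/eqP/setP => u; rewrite !inE.
have [uX|uX] := boolP (u \in X); first by rewrite andbF.
rewrite orbF /=; have [uS|] := boolP (u \in S); last by rewrite andbF.
by rewrite (disjointFr SN uS) andbF.
Qed.

Lemma card_explore (n : nat) (a : 'I_n) (S N X : {set 'I_n}) :
  [disjoint S & N] -> X \subset N -> a \in S ->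
  #|S :\ a :|: X| = (#|S :\ a| + #|X|)%N.
Proof.
move=> SN XN aS; rewrite cardsU.
suff -> : (S :\ a) :&: X = set0 by rewrite cards0 subn0.
apply/setP => u; rewrite !inE; have [uX|] := boolP (u \in X); last by rewrite andbF.
by rewrite (disjointFl SN) ?andbF // (subsetP XN).
Qed.

(** Chernoff bound for the exploration, by induction on the remaining time [k];
    [t] counts the discarded vertices.  The last term is the drift accumulated
    over the steps [t], ..., [t + k]. *)
Lemma survival_le_exp (R : realType) (n : nat) (c : R) (k t : nat) (S N : {set 'I_n}) :
  (0 < n)%N -> 0 <= c <= 1 / 4 ->
  [disjoint S & N] -> (t + #|S| + #|N| <= n)%N ->
  survival (1 / n%:R) k S N <=
  expR c ^+ #|S| * expR (c ^+ 2 * k%:R - c * ((k%:R ^+ 2 / 2 + k%:R * t%:R) / n%:R)).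
Proof.
move=> n0 c01; have p01 := inv_nat_prob R n0; set p : R := 1 / n%:R in p01 *.
have [c0 c1] := andP c01; have nR : (0 : R) < n%:R by rewrite ltr0n.
elim: k t S N => [|k IH] t S N SN tSN.
  apply: le_trans (survival_le1 _ _ _ p01) _.
  rewrite expr0n /= !(mul0r, mulr0) addr0 mul0r mulr0 subr0 expR0 mulr1.
  by rewrite exprn_ege1 // -expR0 ler_expR.
have [->|[a aS]] := set_0Vmem S.
  by rewrite survival_set0 mulr_ge0 ?exprn_ge0 ?expR_ge0.
apply: le_trans (survival_step _ p01 aS SN) _.
set r := #|S :\ a|; have Sr : #|S| = r.+1 by rewrite (cardsD1 a) aS.
set B := expR (c ^+ 2 * k%:R - c * ((k%:R ^+ 2 / 2 + k%:R * t.+1%:R) / n%:R)).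
apply: (@le_trans _ _ (subset_expect p N (fun X => expR c ^+ r * B * expR c ^+ #|X|))).
  apply: subset_expect_le => // X XN.
  apply: le_trans (IH t.+1 _ _ (disjoint_explore _ SN XN) _) _.
    rewrite (card_explore SN XN aS) -/r cardsD (setIidPr XN).
    have := subset_leq_card XN; move: tSN; rewrite Sr.
    move: #|X| #|N| => x m tSN xm.
    by rewrite addnA -addnA subnKC // addSnnS.
  by rewrite (card_explore SN XN aS) exprD mulrAC.
rewrite subset_expectZ subset_expect_expn Sr exprSr -[leLHS]mulrA -[leRHS]mulrA.
rewrite ler_wpM2l ?exprn_ge0 ?expR_ge0 //.
have mdn : (#|N| + t.+1 <= n)%N.
  by apply: leq_trans tSN; rewrite Sr addnC leq_add2r addnS ltnS leq_addr.
have := binomial_mgf_le n0 c01 mdn; rewrite -/p => mgf.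
apply: le_trans (ler_wpM2l (expR_ge0 _) mgf) _.
rewrite /B -!expRD ler_expR -subr_ge0.
rewrite [leRHS](_ : _ = c / (2 * n%:R)); first by rewrite divr_ge0 // mulr_ge0 ?ler0n.
by rewrite !mulrS; field; rewrite gt_eqF.
Qed.

(** The right-hand side is [L] times a potential depending on the number of active
    vertices and on the remaining time [j].  It is superharmonic with room to
    spare: at one step it decreases, on average, by at least
    [(expR (c ^+ 2) - 1) * expR c ^+ #|S|].  It combines a bounded part, whose
    decrease pays for [expR (- (2 * c)) ^+ #|S|], and a part that vanishes when
    [S] is empty and pays for the rest. *)
Lemma sum_survival_le (R : realType) (n : nat) (c L : R) (K j : nat) (S N : {set 'I_n}) :
  (1000 <= n)%N -> 0 <= c <= 1 / 4 -> 0 <= L ->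
  (forall S N : {set 'I_n}, [disjoint S & N] -> (#|S| + #|N| <= n)%N ->
     survival (1 / n%:R) K S N <= L * expR c ^+ #|S|) ->
  [disjoint S & N] -> (#|S| + #|N| <= n)%N ->
  (expR (c ^+ 2) - 1) * \sum_(i < j) survival (1 / n%:R) (K + i) S N <=
  L * (1 - expR (- (2 * c)) ^+ #|S|
       + (expR (c ^+ 2) - 1) * (j%:R * expR (c ^+ 2) ^+ j)
           * (expR c ^+ #|S| - expR (- (2 * c)) ^+ #|S|)).
Proof.
move=> n1000 c01 L0 HK; have n0 : (0 < n)%N by exact: leq_trans n1000.
have p01 := inv_nat_prob R n0; set p : R := 1 / n%:R in p01 HK *.
have [c0 c1] := andP c01.
set l := expR (c ^+ 2); set z := expR c; set w := expR (- (2 * c)).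
have l1 : 1 <= l by rewrite -expR0 ler_expR sqr_ge0.
have z1 : 1 <= z by rewrite -expR0 ler_expR.
have w0 : 0 <= w by rewrite expR_ge0.
have w1 : w <= 1 by rewrite -[leRHS]expR0 ler_expR; lra.
have wz s : w ^+ s <= z ^+ s by rewrite (@le_trans _ _ 1) ?exprn_ile1 ?exprn_ege1.
elim: j S N => [|j IH] S N SN leSN.
  rewrite big_ord0 mulr0 mulr_ge0 // mul0r mulr0 mul0r addr0.
  by rewrite subr_ge0 exprn_ile1.
have [S0|[a aS]] := set_0Vmem S.
  rewrite big1 => [|i _]; last by rewrite S0 survival_set0.
  by rewrite S0 cards0 !expr0 !subrr !mulr0 addr0 mulr0.
rewrite big_ord_recl addn0 mulrDr.
have l10 : 0 <= l - 1 by rewrite subr_ge0.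
apply: (@le_trans _ _ ((l - 1) * (L * z ^+ #|S|) + (l - 1) * \sum_(i < j)
    subset_expect p N (fun X => survival p (K + i) (S :\ a :|: X) (N :\: X)))).
  rewrite lerD // ler_wpM2l ?HK //; apply: ler_sum => i _.
  by rewrite lift0 addnS; exact: survival_step.
rewrite subset_expect_sum -subset_expectZ.
set C := (l - 1) * (j%:R * l ^+ j).
have C0 : 0 <= C by rewrite mulr_ge0 // mulr_ge0 ?exprn_ge0 // (le_trans _ l1).
set r := #|S :\ a|; have Sr : #|S| = r.+1 by rewrite (cardsD1 a) aS.
apply: (@le_trans _ _ ((l - 1) * (L * z ^+ #|S|) + subset_expect p N (fun X =>
    L * C * z ^+ r * z ^+ #|X| + (- (L * (1 + C) * w ^+ r) * w ^+ #|X| + L * 1 ^+ #|X|)))).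
  rewrite lerD2l; apply: subset_expect_le => // X XN.
  apply: le_trans (IH _ _ (disjoint_explore _ SN XN) _) _.
    rewrite (card_explore SN XN aS) -/r cardsD (setIidPr XN) -addnA subnKC ?subset_leq_card //.
    by apply: leq_trans leSN; rewrite leq_add2r Sr.
  rewrite (card_explore SN XN aS) -/r -/C !exprD expr1n le_eqVlt.
  by apply/orP; left; apply/eqP; ring.
rewrite !subset_expectD !subset_expectZ !subset_expect_expn subrr mulr0 addr0 expr1n mulr1.
have Mz : (1 + p * (z - 1)) ^+ #|N| <= z * l.
  have := @binomial_mgf_le R n #|N| 0 c n0 c01; rewrite mul0r mulr0 subr0 addn0 expRD; apply.
  by apply: leq_trans leSN; rewrite leq_addl.
have Mw : w * l <= (1 + p * (w - 1)) ^+ #|N|.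
  have := @binomial_mgf_ge R n #|N| c n1000 c01; rewrite addrC expRD; apply.
  by apply: leq_trans leSN; rewrite leq_addl.
apply: (@le_trans _ _ ((l - 1) * (L * z ^+ #|S|) + (L * C * z ^+ r * (z * l)
    + (- (L * (1 + C) * w ^+ r) * (w * l) + L)))).
  have z0 : 0 <= z by apply: le_trans z1.
  rewrite lerD2l; apply: lerD.
    by apply: ler_wpM2l Mz; apply: mulr_ge0; [exact: mulr_ge0 | exact: exprn_ge0].
  rewrite lerD2r !mulNr lerN2; apply: ler_wpM2l Mw.
  by apply: mulr_ge0; [apply: mulr_ge0 => //; exact: addr_ge0 | exact: exprn_ge0].
have lj : 1 <= l ^+ j.+1 by rewrite exprn_ege1.
have := wz #|S|; rewrite Sr => wzS.
rewrite -subr_ge0 [leRHS](_ : _ = L * (l - 1) * (l ^+ j.+1 - 1) * (z ^+ r.+1 - w ^+ r.+1)).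
  by rewrite !mulr_ge0 ?subr_ge0.
by rewrite /C !exprSr mulrSr; ring.
Qed.

(** Survival probabilities decrease in time, so the last of them is at most their
    average over the last [k] times. *)
Lemma survival_le_prefactor (R : realType) (n : nat) (c : R) (K k : nat) (S N : {set 'I_n}) :
  (1000 <= n)%N -> 0 < c <= 1 / 4 -> (0 < k)%N ->
  [disjoint S & N] -> #|S| = 1%N -> (#|S| + #|N| <= n)%N ->
  survival (1 / n%:R) (K + k) S N <=
  expR (c ^+ 2 * (K + k)%:R - c * (K%:R ^+ 2 / (2 * n%:R))) * (2 / (c * k%:R) + 4 * c).
Proof.
move=> n1000 /andP[c0 c14] k0 SN S1 leSN.
have c01 : 0 <= c <= 1 / 4 by rewrite ltW.
have n0 : (0 < n)%N by exact: leq_trans n1000.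
have p01 := inv_nat_prob R n0.
set L := expR (c ^+ 2 * K%:R - c * (K%:R ^+ 2 / (2 * n%:R))).
have L0 : 0 <= L by rewrite expR_ge0.
have kR : (0 : R) < k%:R by rewrite ltr0n.
have HK (S' N' : {set 'I_n}) : [disjoint S' & N'] -> (#|S'| + #|N'| <= n)%N ->
    survival (1 / n%:R) K S' N' <= L * expR c ^+ #|S'|.
  move=> S'N' leS'N'; have := @survival_le_exp _ _ _ K 0 S' N' n0 c01 S'N'.
  rewrite add0n mulr0 addr0 -mulrA -invfM [_ * expR _]mulrC; exact.
have := sum_survival_le k n1000 c01 L0 HK SN leSN; rewrite S1 !expr1.
set l := expR (c ^+ 2); set w := expR (- (2 * c)); set z := expR c => Sum.
have l1 : c ^+ 2 <= l - 1 by have := expR_ge1Dx (c ^+ 2); rewrite -/l; lra.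
have w1 : 1 - w <= 2 * c by have := expR_ge1Dx (- (2 * c)); rewrite -/w; lra.
have zw : z - w <= 4 * c.
  have := expR_le_quadratic c01; rewrite -/z => z1.
  have : c ^+ 2 <= c / 4 by rewrite expr2; nra.
  by lra.
have c2 : 0 < c ^+ 2 by rewrite exprn_gt0.
have lk1 : 1 <= l ^+ k by rewrite exprn_ege1 // -[leLHS]expR0 ler_expR ltW.
have avg : k%:R * survival (1 / n%:R : R) (K + k) S N <=
    \sum_(i < k) survival (1 / n%:R) (K + i) S N.
  rewrite mulr_natl -[X in _ *+ X]card_ord -sumr_const; apply: ler_sum => i _.
  by apply: survival_mono => //; rewrite leq_add2l ltnW.
have l10 : 0 < l - 1 by exact: lt_le_trans l1.
rewrite -(ler_pM2l kR) -(ler_pM2l l10).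
apply: le_trans (ler_wpM2l (ltW l10) avg) _; apply: le_trans Sum _.
rewrite [X in expR X](_ : _ = c ^+ 2 * K%:R - c * (K%:R ^+ 2 / (2 * n%:R)) + k%:R * c ^+ 2);
  last by rewrite natrD; ring.
rewrite expRD expRM_natl -/L -/l.
rewrite [leRHS](_ : _ = L * (l ^+ k * (2 / c) * (l - 1) + (l - 1) * (k%:R * l ^+ k) * (4 * c)));
  last by field; rewrite !gt_eqF.
rewrite ler_wpM2l // lerD //.
  apply: (le_trans w1); apply: (@le_trans _ _ (2 / c * (l - 1))).
    rewrite [leLHS](_ : _ = 2 / c * c ^+ 2); last by field; rewrite gt_eqF.
    by rewrite ler_wpM2l // divr_ge0 // ltW.
  by rewrite -[leRHS]mulrA ler_peMl // mulr_ge0 ?(ltW l10) // divr_ge0 // ltW.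
by rewrite ler_wpM2l // !mulr_ge0 ?(ltW l10) ?(ltW kR) // (le_trans _ lk1).
Qed.

(** Here [y] stands for the cube root of the number of vertices, [k] for the integer
    part of [y ^+ 2] and [K + k] for that of [A * y ^+ 2].  The exponent [c = A / (4 * y)] minimizes
    [c ^+ 2 * T - c * (T ^+ 2 / (2 * y ^+ 3))] at [T = A * y ^+ 2]. *)
Lemma component_tail_numeric (R : realType) (y A K k : R) :
  10 <= y -> 8 < A -> A < y -> 0 < k -> y ^+ 2 < k + 1 -> k <= y ^+ 2 ->
  K + k <= A * y ^+ 2 -> A * y ^+ 2 < K + k + 1 ->
  expR ((A / (4 * y)) ^+ 2 * (K + k) - A / (4 * y) * (K ^+ 2 / (2 * y ^+ 3)))
    * (2 / (A / (4 * y) * k) + 4 * (A / (4 * y)))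
  <= 4 * y^-1 * expR (- (A ^+ 2 * (A - 4) / 32)).
Proof.
move=> y10 A8 Ay k0 ltk lek leKk ltKk.
have y0 : 0 < y by lra.
have y2 : 100 <= y ^+ 2 by rewrite expr2; nra.
have y20 : 0 < y ^+ 2 by lra.
have pre : 2 / (A / (4 * y) * k) + 4 * (A / (4 * y)) <= (A + 2) / y.
  rewrite [leLHS](_ : _ = (A + 8 * y ^+ 2 / (A * k)) / y); last first.
    by field; rewrite !gt_eqF //; lra.
  rewrite ler_wpM2r ?invr_ge0 ?(ltW y0) // lerD2l ler_pdivrMr; last by rewrite mulr_gt0 //; lra.
  by nra.
(* Integer parts cost at most 1, that is [y ^+ 2 / 100], so [K] is at least
   [(A - 101 / 100) * y ^+ 2]. *)
have expo : (A / (4 * y)) ^+ 2 * (K + k) - A / (4 * y) * (K ^+ 2 / (2 * y ^+ 3))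
    <= A ^+ 3 / 16 - A * (A - 101 / 100) ^+ 2 / 8.
  apply: lerB.
    rewrite [leRHS](_ : _ = (A / (4 * y)) ^+ 2 * (A * y ^+ 2)); last by field; rewrite gt_eqF.
    by rewrite ler_wpM2l // sqr_ge0.
  rewrite [leRHS](_ : _ = A / 8 * (K / y ^+ 2) ^+ 2); last by field; rewrite gt_eqF.
  rewrite mulrAC ler_wpM2l //; first by lra.
  have KA : A - 101 / 100 <= K / y ^+ 2 by rewrite ler_pdivlMr //; nra.
  by rewrite lerXn2r ?nnegrE //; lra.
apply: (@le_trans _ _ (expR (A ^+ 3 / 16 - A * (A - 101 / 100) ^+ 2 / 8) * ((A + 2) / y))).
  apply: ler_pM; rewrite ?expR_ge0 ?ler_expR //.
  have c0 : 0 <= A / (4 * y) by rewrite divr_ge0 //; lra.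
  apply: addr_ge0; last exact: mulr_ge0.
  by apply: divr_ge0 => //; apply: mulr_ge0 => //; exact: ltW.
set E := A ^+ 3 / 16 - _; set G := - (_ / 32).
have -> : expR G = expR E * expR (G - E) by rewrite -expRD addrC subrK.
rewrite [leRHS](_ : _ = expR E * (4 * expR (G - E) / y)); last by ring.
rewrite ler_wpM2l ?expR_ge0 // ler_wpM2r ?invr_ge0 ?(ltW y0) //.
apply: (@le_trans _ _ (4 * (1 + (G - E)))); last by rewrite ler_wpM2l // expR_ge1Dx.
(* The target exponent [G] exceeds [E] by about [A ^+ 3 / 32], which leaves
   room for the factor [A + 2]. *)
suff : A <= G - E by lra.
rewrite /G /E; have : 8 * A <= A ^+ 2 by rewrite expr2; nra.
have : 8 * A ^+ 2 <= A ^+ 3 by rewrite exprS ler_wpM2r ?sqr_ge0 // ltW.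
by nra.
Qed.

(** * Tails of the component sizes *)

Lemma component_eq (n : nat) (G : {set {set 'I_n}}) (u v : 'I_n) :
  v \in component G u -> component G v = component G u.
Proof.
have sym : connect_sym (Defs.adjacent G).
  by apply: sym_connect_sym => a b; rewrite /Defs.adjacent setUC.
by rewrite inE => uv; apply/setP => w; rewrite !inE (same_connect sym uv).
Qed.

Lemma largest_componentP (n : nat) (G : {set {set 'I_n}}) :
  (0 < n)%N -> exists u, largest_component_size G = #|component G u|.
Proof.
move=> n0; have : (0 < #|components G|)%N.
  by apply/card_gt0P; exists (component G (Ordinal n0)); apply: imset_f.
by case/(eq_bigmax_cond (fun C : {set 'I_n} => #|C|)) => _ /imsetP[u _ ->] E; exists u.
Qed.

(** If the largest component has more than [t] vertices, then so does the component
    of each of its vertices; so more than [t] of the indicators on the right are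
    1, and Markov's inequality applies. *)
Lemma gnp_prob_largest_le (R : realType) (n : nat) (p t : R) :
  0 <= p <= 1 -> 0 < t -> (0 < n)%N ->
  gnp_prob p (fun G : {set {set 'I_n}} => t < (largest_component_size G)%:R) <=
  (\sum_(v : 'I_n)
     gnp_prob p (fun G : {set {set 'I_n}} => t < #|component G v|%:R)) / t.
Proof.
move=> p01 t0 n0; rewrite ler_pdivlMr // mulrC.
under eq_bigr do rewrite gnp_probE; rewrite gnp_probE.
rewrite /gnp_expect exchange_big mulr_sumr; apply: ler_sum => G _ /=.
rewrite -mulr_sumr mulrCA ler_wpM2l ?gnp_weight_ge0 //.
have [u ->] := largest_componentP G n0.
case: ltP => [tu|_]; last by rewrite mulr0 sumr_ge0.
rewrite mulr1; apply: (le_trans (ltW tu)).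
rewrite -sum1_card natr_sum big_mkcond /=; apply: ler_sum => v _.
by case: ifP => // /component_eq ->; rewrite tu.
Qed.

Lemma component_tail (R : realType) (n : nat) (A y : R) (v : 'I_n) :
  (1000 <= n)%N -> 10 <= y -> y ^+ 3 = n%:R -> 8 < A ->
  gnp_prob (1 / n%:R)
    (fun G : {set {set 'I_n}} => A * y ^+ 2 < #|component G v|%:R)
  <= 4 * y^-1 * expR (- (A ^+ 2 * (A - 4) / 32)).
Proof.
move=> n1000 y10 yn A8.
have n0 : (0 < n)%N by exact: leq_trans n1000.
have p01 := inv_nat_prob R n0.
have y0 : 0 < y by lra.
have y2 : 100 <= y ^+ 2 by rewrite expr2; nra.
(* For [y <= A] the threshold is at least the number of vertices. *)
have [yA|Ay] := leP y A.
  rewrite gnp_probE /gnp_expect big1 ?mulr_ge0 ?expR_ge0 ?invr_ge0 ?(ltW y0) //.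
  move=> G _; suff -> : A * y ^+ 2 < #|component G v|%:R = false by rewrite mulr0.
  apply/negbTE; rewrite -leNgt; apply: (@le_trans _ _ n%:R).
    by rewrite ler_nat -[X in (_ <= X)%N]card_ord max_card.
  by rewrite -yn exprS ler_wpM2r ?sqr_ge0.
set k := Num.truncn (y ^+ 2); set M := Num.truncn (A * y ^+ 2).
have /andP[lek ltk] := truncn_itv (sqr_ge0 y).
have Ay2 : 0 <= A * y ^+ 2 by rewrite mulr_ge0 ?sqr_ge0 //; lra.
have /andP[leM ltM] := truncn_itv Ay2.
rewrite -/k -/M -!natr1 in lek ltk leM ltM.
have kM : (k <= M)%N by apply: le_truncn; rewrite ler_peMl ?sqr_ge0 //; lra.
have k0 : (0 < k)%N by rewrite truncn_gt0; lra.
apply: (@le_trans _ _ (survival (1 / n%:R) M [set v] (~: [set v]))).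
  rewrite gnp_probE; apply: gnp_expect_le => // G; rewrite ler_nat.
  case: ltP => // Acomp; rewrite lt0b.
  apply: leq_trans (subset_leq_card (sub_reach_component G v)).
  by rewrite -(ltr_nat R); apply: le_lt_trans Acomp.
rewrite -(subnK kM) in leM ltM *; rewrite natrD in leM ltM.
have c0 : 0 < A / (4 * y) <= 1 / 4.
  apply/andP; split; first by rewrite divr_gt0 //; lra.
  by rewrite ler_pdivrMr; lra.
have dis : [disjoint [set v] & ~: [set v]] by rewrite -setI_eq0 setICr.
apply: le_trans (survival_le_prefactor _ n1000 c0 k0 dis (cards1 v) _) _.
  by rewrite -cardsUI setUCr setICr cards0 addn0 cardsT card_ord.
rewrite -yn natrD; apply: component_tail_numeric => //; by rewrite ltr0n.
Qed.

Theorem theorem1 (R : realType) (n : nat) (A : R)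
    (hn : (1000 < n)%N) (hA : 8 < A) :
  (forall v : 'I_n,
     gnp_prob (1 / n%:R)
       (fun G : {set {set 'I_n}} =>
          A * n%:R `^ (2 / 3) < #|component G v|%:R)
     <= 4 * n%:R `^ (- (1 / 3)) * expR (- (A ^+ 2 * (A - 4) / 32)))
  /\
  gnp_prob (1 / n%:R)
    (fun G : {set {set 'I_n}} =>
       A * n%:R `^ (2 / 3) < (largest_component_size G)%:R)
  <= 4 / A * expR (- (A ^+ 2 * (A - 4) / 32)).
Proof.
set y : R := n%:R `^ (1 / 3).
have y2E : n%:R `^ (2 / 3) = y ^+ 2.
  by rewrite -powR_mulrn ?powR_ge0 // -powRrM; congr (_ `^ _); field.
have yn : y ^+ 3 = n%:R.
  rewrite -powR_mulrn ?powR_ge0 // -powRrM (_ : 1 / 3 * 3 = 1) ?powRr1 ?ler0n //.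
  by field.
rewrite y2E powRN -/y.
have y10 : 10 <= y.
  rewrite leNgt; apply/negP => y10; have : y ^+ 3 < 10 ^+ 3.
    by rewrite ltrXn2r ?nnegrE ?powR_ge0.
  by rewrite yn -natrX ltr_nat ltnNge (ltnW hn).
have tail v := @component_tail R n A y v (ltnW hn) y10 yn hA.
split=> //.
have y0 : 0 < y by lra.
have A0 : 0 < A by lra.
have t0 : 0 < A * y ^+ 2 by rewrite mulr_gt0 ?exprn_gt0.
have n0 : (0 < n)%N by exact: ltn_trans hn.
have p01 := inv_nat_prob R n0.
apply: le_trans (gnp_prob_largest_le p01 t0 n0) _; rewrite ler_pdivrMr //.
apply: le_trans (ler_sum _ (fun v _ => tail v)) _.
rewrite sumr_const card_ord -[leLHS]mulr_natl -yn le_eqVlt; apply/orP; left; apply/eqP.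
by field; rewrite !gt_eqF.
Qed.
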